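(* Let $(A,\cdot,[\cdot,\cdot,\cdot])$ be a ternary $F$-manifold algebra and $T:V\to A$ a relative Rota-Baxter operator on $A$ with respect to a representation $(V;\rho,\mu)$. Define two operations on $V$ by $$u\diamond v=\mu(Tu)v,\qquad \{u,v,w\}=\rho(Tu,Tv)w,\qquad u,v,w\in V.$$ Then $(V,\diamond,\{\cdot,\cdot,\cdot\})$ is a ternary pre-$F$-manifold algebra, and $T$ is a homomorphism of ternary $F$-manifold algebras from the sub-adjacent ternary $F$-manifold algebra $V^c$ to $(A,\cdot,[\cdot,\cdot,\cdot])$.
   Context: All vector spaces are over an algebraically closed field $\mathbb K$ of characteristic $0$. A 3-Lie algebra is a vector space $A$ with a skew-symmetric trilinear bracket satisfying $[x_1,x_2,[x_3,x_4,x_5]]=[[x_1,x_2,x_3],x_4,x_5]+[x_3,[x_1,x_2,x_4],x_5]+[x_3,x_4,[x_1,x_2,x_5]]$. A ternary $F$-manifold algebra is $(A,\cdot,[\cdot,\cdot,\cdot])$ with $(A,\cdot)$ commutative associative and $(A,[\cdot,\cdot,\cdot])$ a 3-Lie algebra such that, with $\mathcal L(x_1,x_2,x_3,x_4)=[x_1,x_2,x_3\cdot x_4]-x_3\cdot[x_1,x_2,x_4]-[x_1,x_2,x_3]\cdot x_4$, one has $\mathcal L(x_1\cdot x_2,x_3,x_4,x_5)=x_1\cdot\mathcal L(x_2,x_3,x_4,x_5)+x_2\cdot\mathcal L(x_1,x_3,x_4,x_5)$. A homomorphism of ternary $F$-manifold algebras is a linear map preserving both operations. A representation of a commutative associative algebra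 $(A,\cdot)$ on $V$ is a linear map $\mu:A\to\mathfrak{gl}(V)$ with $\mu(x\cdot y)=\mu(x)\mu(y)$. A representation of a 3-Lie algebra $A$ on $V$ is a skew-symmetric bilinear map $\rho:A\otimes A\to\mathfrak{gl}(V)$ with (i) $\rho(x_1,x_2)\rho(x_3,x_4)-\rho(x_3,x_4)\rho(x_1,x_2)=\rho([x_1,x_2,x_3],x_4)-\rho([x_1,x_2,x_4],x_3)$; (ii) $\rho([x_1,x_2,x_3],x_4)=\rho(x_1,x_2)\rho(x_3,x_4)+\rho(x_2,x_3)\rho(x_1,x_4)+\rho(x_3,x_1)\rho(x_2,x_4)$. $(V;\rho,\mu)$ is a representation of the ternary $F$-manifold algebra $A$ if $\rho$ is a representation of the 3-Lie algebra, $\mu$ is a representation of the commutative associative algebra, and, with $\mathcal L_1(x,y,z,u)=\rho(x,y)\mu(z)u-\mu(z)\rho(x,y)u-\mu([x,y,z])u$ and $\mathcal L_2(x,y,z,u)=\mu(z)\rho(x,y)u+\mu(y)\rho(x,z)u-\rho(x,y\cdot z)u$, for all $x_i\in A$, $u\in V$: $\mathcal L_1(x_1\cdot x_2,x_3,x_4,u)=\mu(x_1)\mathcal L_1(x_2,x_3,x_4,u)+\mu(x_2)\mathcal L_1(x_1,x_3,x_4,u)$; $\mathcal L_2(x_1\cdot x_2,x_3,x_4,u)=\mu(x_1)\mathcal L_2(x_2,x_3,x_4,u)+\mu(x_2)\mathcal L_2(x_1,x_3,x_4,u)$; $\mu(\mathcal L(x_1,x_2,x_3,x_4))u=\mu(x_1)\mathcal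 L_2(x_2,x_3,x_4,u)-\mathcal L_2(x_2,x_3,x_4,\mu(x_1)u)$. A relative Rota-Baxter operator on $A$ with respect to $(V;\rho,\mu)$ is a linear map $T:V\to A$ with $Tu\cdot Tv=T(\mu(Tu)v+\mu(Tv)u)$ and $[Tu,Tv,Tw]=T(\rho(Tu,Tv)w+\rho(Tv,Tw)u+\rho(Tw,Tu)v)$ for all $u,v,w\in V$. A Zinbiel algebra is $(A,\diamond)$ with $\diamond$ bilinear and $x\diamond(y\diamond z)=(y\diamond x)\diamond z+(x\diamond y)\diamond z$. A 3-pre-Lie algebra is $(A,\{\cdot,\cdot,\cdot\})$ with a trilinear bracket satisfying, with $[x,y,z]=\{x,y,z\}+\{y,z,x\}+\{z,x,y\}$: $\{x,y,z\}=-\{y,x,z\}$; $\{x_1,x_2,\{x_3,x_4,x_5\}\}=\{[x_1,x_2,x_3],x_4,x_5\}+\{x_3,[x_1,x_2,x_4],x_5\}+\{x_3,x_4,\{x_1,x_2,x_5\}\}$; $\{[x_1,x_2,x_3],x_4,x_5\}=\{x_1,x_2,\{x_3,x_4,x_5\}\}+\{x_2,x_3,\{x_1,x_4,x_5\}\}+\{x_3,x_1,\{x_2,x_4,x_5\}\}$. A ternary pre-$F$-manifold algebra is $(A,\diamond,\{\cdot,\cdot,\cdot\})$ with $(A,\diamond)$ a Zinbiel algebra and $(A,\{\cdot,\cdot,\cdot\})$ a 3-pre-Lie algebra such that, with $x\cdot y=x\diamond y+y\diamond x$, $[x,y,z]=\{x,y,z\}+\{y,z,x\}+\{z,x,y\}$,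 $F_1(x_1,x_2,x_3,x_4)=\{x_1,x_2,x_3\diamond x_4\}-x_3\diamond\{x_1,x_2,x_4\}-[x_1,x_2,x_3]\diamond x_4$, $F_2(x_1,x_2,x_3,x_4)=x_3\diamond\{x_1,x_2,x_4\}+x_2\diamond\{x_1,x_3,x_4\}-\{x_1,x_2\cdot x_3,x_4\}$, $\mathcal L(x_1,x_2,x_3,x_4)=[x_1,x_2,x_3\cdot x_4]-x_3\cdot[x_1,x_2,x_4]-[x_1,x_2,x_3]\cdot x_4$, one has for all $x_i\in A$: $F_1(x_1\cdot x_2,x_3,x_4,x_5)=x_1\diamond F_1(x_2,x_3,x_4,x_5)+x_2\diamond F_1(x_1,x_3,x_4,x_5)$; $F_2(x_1\cdot x_2,x_3,x_4,x_5)=x_1\diamond F_2(x_2,x_3,x_4,x_5)+x_2\diamond F_2(x_1,x_3,x_4,x_5)$; $\mathcal L(x_1,x_2,x_3,x_4)\diamond x_5=x_1\diamond F_2(x_2,x_3,x_4,x_5)-F_2(x_2,x_3,x_4,x_1\diamond x_5)$. Its sub-adjacent ternary $F$-manifold algebra $A^c$ is $(A,\cdot,[\cdot,\cdot,\cdot])$ with these operations $\cdot$ and $[\cdot,\cdot,\cdot]$. *)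

(* Defs.v *)
From mathcomp Require Import all_boot all_order all_algebra.

Set Implicit Arguments.
Unset Strict Implicit.
Unset Printing Implicit Defensive.

Import GRing.Theory.
Local Open Scope ring_scope.

(* Vector spaces are lmodTypes, of arbitrary dimension. A map into gl(V) is
   curried, with the vector acted upon as last argument, so that a linear map
   A -> gl(V) is a bilinear map A -> V -> V, and a bilinear map A x A -> gl(V)
   is a trilinear map A -> A -> V -> V. *)

Section Multilinear.
Variables (K : fieldType) (U1 U2 U3 W : lmodType K).

Definition bilinear_map (f : U1 -> U2 -> W) : Prop :=
  (forall y, linear (fun x => f x y)) /\ (forall x, linear (f x)).

Definition trilinear_map (f : U1 -> U2 -> U3 -> W) : Prop :=
  [/\ forall y z, linear (fun x => f x y z),
      forall x z, linear (fun y => f x y z) &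
      forall x y, linear (f x y)].

End Multilinear.

Section TernaryFManifold.
Variables (K : fieldType) (A : lmodType K).
Variables (mul : A -> A -> A) (br : A -> A -> A -> A).

Record is_com_assoc_algebra : Prop := IsComAssocAlgebra {
  caa_bilinear : bilinear_map mul;
  caa_comm : forall x y, mul x y = mul y x;
  caa_assoc : forall x y z, mul x (mul y z) = mul (mul x y) z
}.

Record is_3Lie_algebra : Prop := Is3LieAlgebra {
  lie3_trilinear : trilinear_map br;
  (* the two adjacent transpositions generate the symmetric group on the
     three arguments *)
  lie3_skew12 : forall x y z, br x y z = - br y x z;
  lie3_skew23 : forall x y z, br x y z = - br x z y;
  lie3_fundamental : forall x1 x2 x3 x4 x5,
    br x1 x2 (br x3 x4 x5) =
      br (br x1 x2 x3) x4 x5 + br x3 (br x1 x2 x4) x5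
      + br x3 x4 (br x1 x2 x5)
}.

Definition leibnizator (x1 x2 x3 x4 : A) : A :=
  br x1 x2 (mul x3 x4) - mul x3 (br x1 x2 x4) - mul (br x1 x2 x3) x4.

Record is_ternaryF_manifold : Prop := IsTernaryFManifold {
  tF_com_assoc : is_com_assoc_algebra;
  tF_3Lie : is_3Lie_algebra;
  tF_compat : forall x1 x2 x3 x4 x5,
    leibnizator (mul x1 x2) x3 x4 x5 =
      mul x1 (leibnizator x2 x3 x4 x5) + mul x2 (leibnizator x1 x3 x4 x5)
}.

End TernaryFManifold.

Definition is_ternaryF_hom (K : fieldType) (A B : lmodType K)
    (mulA : A -> A -> A) (brA : A -> A -> A -> A)
    (mulB : B -> B -> B) (brB : B -> B -> B -> B)
    (phi : {linear A -> B}) : Prop :=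
  (forall x y, phi (mulA x y) = mulB (phi x) (phi y)) /\
  (forall x y z, phi (brA x y z) = brB (phi x) (phi y) (phi z)).

Section Representation.
Variables (K : fieldType) (A V : lmodType K).
Variables (mul : A -> A -> A) (br : A -> A -> A -> A).
Variables (rho : A -> A -> V -> V) (mu : A -> V -> V).

Record is_com_assoc_rep : Prop := IsComAssocRep {
  car_bilinear : bilinear_map mu;
  car_mul : forall x y v, mu (mul x y) v = mu x (mu y v)
}.

Record is_3Lie_rep : Prop := Is3LieRep {
  lr3_trilinear : trilinear_map rho;
  lr3_skew : forall x y v, rho x y v = - rho y x v;
  lr3_comm : forall x1 x2 x3 x4 v,
    rho x1 x2 (rho x3 x4 v) - rho x3 x4 (rho x1 x2 v) =
      rho (br x1 x2 x3) x4 v - rho (br x1 x2 x4) x3 v;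
  lr3_bracket : forall x1 x2 x3 x4 v,
    rho (br x1 x2 x3) x4 v =
      rho x1 x2 (rho x3 x4 v) + rho x2 x3 (rho x1 x4 v)
      + rho x3 x1 (rho x2 x4 v)
}.

Definition rep_L1 (x y z : A) (u : V) : V :=
  rho x y (mu z u) - mu z (rho x y u) - mu (br x y z) u.

Definition rep_L2 (x y z : A) (u : V) : V :=
  mu z (rho x y u) + mu y (rho x z u) - rho x (mul y z) u.

Record is_ternaryF_rep : Prop := IsTernaryFRep {
  tFr_3Lie : is_3Lie_rep;
  tFr_com_assoc : is_com_assoc_rep;
  tFr_L1 : forall x1 x2 x3 x4 u,
    rep_L1 (mul x1 x2) x3 x4 u =
      mu x1 (rep_L1 x2 x3 x4 u) + mu x2 (rep_L1 x1 x3 x4 u);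
  tFr_L2 : forall x1 x2 x3 x4 u,
    rep_L2 (mul x1 x2) x3 x4 u =
      mu x1 (rep_L2 x2 x3 x4 u) + mu x2 (rep_L2 x1 x3 x4 u);
  tFr_L : forall x1 x2 x3 x4 u,
    mu (leibnizator mul br x1 x2 x3 x4) u =
      mu x1 (rep_L2 x2 x3 x4 u) - rep_L2 x2 x3 x4 (mu x1 u)
}.

Record is_relative_Rota_Baxter (T : {linear V -> A}) : Prop :=
  IsRelativeRotaBaxter {
  rrb_mul : forall u v,
    mul (T u) (T v) = T (mu (T u) v + mu (T v) u);
  rrb_br : forall u v w,
    br (T u) (T v) (T w) =
      T (rho (T u) (T v) w + rho (T v) (T w) u + rho (T w) (T u) v)
}.

End Representation.

Section TernaryPreFManifold.
Variables (K : fieldType) (A : lmodType K).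
Variables (dia : A -> A -> A) (tri : A -> A -> A -> A).

Definition subadj_mul (x y : A) : A := dia x y + dia y x.

Definition subadj_br (x y z : A) : A := tri x y z + tri y z x + tri z x y.

Record is_Zinbiel_algebra : Prop := IsZinbielAlgebra {
  zin_bilinear : bilinear_map dia;
  zin_identity : forall x y z,
    dia x (dia y z) = dia (dia y x) z + dia (dia x y) z
}.

Record is_3preLie_algebra : Prop := Is3PreLieAlgebra {
  pl3_trilinear : trilinear_map tri;
  pl3_skew : forall x y z, tri x y z = - tri y x z;
  pl3_derivation : forall x1 x2 x3 x4 x5,
    tri x1 x2 (tri x3 x4 x5) =
      tri (subadj_br x1 x2 x3) x4 x5 + tri x3 (subadj_br x1 x2 x4) x5
      + tri x3 x4 (tri x1 x2 x5);
  pl3_bracket : forall x1 x2 x3 x4 x5,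
    tri (subadj_br x1 x2 x3) x4 x5 =
      tri x1 x2 (tri x3 x4 x5) + tri x2 x3 (tri x1 x4 x5)
      + tri x3 x1 (tri x2 x4 x5)
}.

Definition preF_F1 (x1 x2 x3 x4 : A) : A :=
  tri x1 x2 (dia x3 x4) - dia x3 (tri x1 x2 x4)
  - dia (subadj_br x1 x2 x3) x4.

Definition preF_F2 (x1 x2 x3 x4 : A) : A :=
  dia x3 (tri x1 x2 x4) + dia x2 (tri x1 x3 x4)
  - tri x1 (subadj_mul x2 x3) x4.

Record is_ternary_preF_manifold : Prop := IsTernaryPreFManifold {
  tpF_Zinbiel : is_Zinbiel_algebra;
  tpF_3preLie : is_3preLie_algebra;
  tpF_F1 : forall x1 x2 x3 x4 x5,
    preF_F1 (subadj_mul x1 x2) x3 x4 x5 =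
      dia x1 (preF_F1 x2 x3 x4 x5) + dia x2 (preF_F1 x1 x3 x4 x5);
  tpF_F2 : forall x1 x2 x3 x4 x5,
    preF_F2 (subadj_mul x1 x2) x3 x4 x5 =
      dia x1 (preF_F2 x2 x3 x4 x5) + dia x2 (preF_F2 x1 x3 x4 x5);
  tpF_L : forall x1 x2 x3 x4 x5,
    dia (leibnizator subadj_mul subadj_br x1 x2 x3 x4) x5 =
      dia x1 (preF_F2 x2 x3 x4 x5) - preF_F2 x2 x3 x4 (dia x1 x5)
}.

End TernaryPreFManifold.

(* Main.v *)
(* Since T is a homomorphism for the operations it induces on V, every pre-F
   axiom on V is a representation axiom evaluated at elements of the image of T.
   For the sub-adjacent structure, L is a sum of values of F1 and F2 (see
   leibnizator_subadj), and the third pre-F identity corrects the failure of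
   F2(x3, x4, x5, -) to be a derivation of the product. *)

Require Import Defs.
From mathcomp Require Import all_boot all_order all_algebra.
Import GRing.Theory.
Local Open Scope ring_scope.

(* Equality of signed sums in a Z-module: the last term of the difference is
   cancelled against its opposite until nothing is left. *)
Ltac move_last t := repeat progress rewrite (addrAC _ t _).
Ltac cancel_last :=
  lazymatch goal with
  | |- (_ - ?t)%R = 0 => move_last t; move_last (- t)%R; rewrite addrK
  | |- (_ + ?t)%R = 0 => move_last (- t)%R; move_last t; rewrite subrK
  end.
Ltac zmod :=
  apply/eqP; rewrite -subr_eq0 -[eqbLHS]add0r; apply/eqP;
  rewrite !(opprD, opprK, addrA);
  repeat cancel_last; reflexivity.

Section LinearProp.
Variables (K : fieldType) (U W : lmodType K).
Implicit Types f g : U -> W.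

Lemma linear_propD f : linear f -> {morph f : x y / x + y}.
Proof. by move=> lf x y; rewrite -[x]scale1r lf !scale1r. Qed.

Lemma linear_propN f : linear f -> {morph f : x / - x}.
Proof.
move=> lf x; have f0 : f 0 = 0.
  by apply: (addrI (f 0)); rewrite -linear_propD // !addr0.
by rewrite -scaleN1r -[_ *: x]addr0 lf f0 addr0 scaleN1r.
Qed.

Lemma linear_propB f : linear f -> {morph f : x y / x - y}.
Proof. by move=> lf x y; rewrite linear_propD // linear_propN. Qed.

Lemma linear_add_fun f g : linear f -> linear g -> linear (fun x => f x + g x).
Proof. by move=> lf lg a x y; rewrite lf lg scalerDr addrACA. Qed.

End LinearProp.

Section SubAdjacent.
Variables (K : fieldType) (A : lmodType K).
Variables (dia : A -> A -> A) (tri : A -> A -> A -> A).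
Local Notation mul := (subadj_mul dia).
Local Notation br := (subadj_br tri).

(** The Zinbiel identity makes left [dia]-multiplication by [mul x y] the composite of those by [x]
    and [y]. Commutativity of [mul] then makes these operators commute, which gives
    associativity. *)
Lemma subadj_mul_com_assoc :
  is_Zinbiel_algebra dia -> is_com_assoc_algebra mul.
Proof.
case=> -[lin1 lin2] zin.
have zinM x y z : dia (mul x y) z = dia x (dia y z).
  by rewrite (linear_propD _ _ _ _ (lin1 z)) zin addrC.
have mulC x y : mul x y = mul y x by rewrite /subadj_mul addrC.
have diaCA x y z : dia x (dia y z) = dia y (dia x z) by rewrite -!zinM mulC.
split=> //.
- by split=> x; apply: linear_add_fun.
- move=> x y z; rewrite {1}/subadj_mul [RHS]/subadj_mul !zinM.
  rewrite /subadj_mul !(linear_propD _ _ _ _ (lin2 _)) (diaCA x z) (diaCA y z).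
  by rewrite addrA.
Qed.

Lemma subadj_br_3Lie : is_3preLie_algebra tri -> is_3Lie_algebra br.
Proof.
case=> -[lin1 lin2 lin3] skew der brE.
have triD x y : {morph tri x y : u v / u + v} := linear_propD _ _ _ _ (lin3 x y).
have triN x y : {morph tri x y : u / - u} := linear_propN _ _ _ _ (lin3 x y).
split.
- by split=> x y; apply: linear_add_fun => //; apply: linear_add_fun.
- move=> x y z; rewrite /subadj_br (skew x y) (skew y z) (skew z x).
  by zmod.
- move=> x y z; rewrite /subadj_br (skew x y) (skew y z) (skew z x).
  by zmod.
move=> x1 x2 x3 x4 x5.
rewrite {1}/subadj_br {1}[br x3 x4 x5]/subadj_br !triD.
rewrite (der _ _ x3 x4) (der _ _ x4 x5) (der _ _ x5 x3).
(* A bracket in the second slot moves to the first, where the bracket identity applies. *)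
rewrite (skew x2 (br _ _ _)) (brE x3 x4 x5 x1) (brE x3 x4 x5 x2).
rewrite [br (br _ _ _) _ _]/subadj_br [br x3 (br _ _ _) _]/subadj_br.
rewrite [br x3 x4 (br _ _ _)]/subadj_br.
(* Only brackets in the last slot are expanded: those that [der] created in the first two slots
   match the right-hand side as they stand. *)
have tri_br y z u v w :
    tri y z (br u v w) =
      tri y z (tri u v w) + tri y z (tri v w u) + tri y z (tri w u v).
  by rewrite /subadj_br !triD.
rewrite !tri_br (skew x5 x2 x1) (skew x4 x2 x1) (skew x3 x2 x1) !triN.
by zmod.
Qed.

(** Of the three terms of [br x1 x2 (mul x3 x4)], the one with the product last goes into the two
    [preF_F1]; the other two, with the product in the second slot up to skew-symmetry, go into the
    two [preF_F2]. *)
Lemma leibnizator_subadj (lin_tri : trilinear_map tri)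
    (skew : forall x y z, tri x y z = - tri y x z)
    (lin_dia : bilinear_map dia) x1 x2 x3 x4 :
  leibnizator mul br x1 x2 x3 x4 =
    preF_F1 dia tri x1 x2 x3 x4 + preF_F1 dia tri x1 x2 x4 x3
    + preF_F2 dia tri x1 x3 x4 x2 - preF_F2 dia tri x2 x3 x4 x1.
Proof.
have [_ lin2] := lin_dia; have [_ _ lin3] := lin_tri.
have diaD x : {morph dia x : u v / u + v} := linear_propD _ _ _ _ (lin2 x).
have diaN x : {morph dia x : u / - u} := linear_propN _ _ _ _ (lin2 x).
have triD x y : {morph tri x y : u v / u + v} := linear_propD _ _ _ _ (lin3 x y).
have dia_br y u v w :
    dia y (br u v w) = dia y (tri u v w) + dia y (tri v w u) + dia y (tri w u v).
  by rewrite /subadj_br !diaD.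
rewrite /leibnizator /preF_F1 /preF_F2.
rewrite [mul x3 (br _ _ _)]/subadj_mul [mul (br _ _ _) x4]/subadj_mul !dia_br.
rewrite [br x1 x2 (mul _ _)]/subadj_br {1}[mul x3 x4]/subadj_mul !triD.
rewrite (skew (mul x3 x4)) (skew x4 x1) (skew x3 x1) !diaN.
by zmod.
Qed.

Lemma subadj_ternaryF_manifold :
  is_ternary_preF_manifold dia tri -> is_ternaryF_manifold mul br.
Proof.
case=> zin pl F1 F2 L; split; first exact: subadj_mul_com_assoc.
  exact: subadj_br_3Lie.
have lin_dia := zin_bilinear zin; have lin_tri := pl3_trilinear pl.
have [_ lin2] := lin_dia; have [_ _ lin3] := lin_tri.
have diaD x : {morph dia x : u v / u + v} := linear_propD _ _ _ _ (lin2 x).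
have diaB x : {morph dia x : u v / u - v} := linear_propB _ _ _ _ (lin2 x).
have triD x y : {morph tri x y : u v / u + v} := linear_propD _ _ _ _ (lin3 x y).
have F2D x y z u v : preF_F2 dia tri x y z (u + v) =
    preF_F2 dia tri x y z u + preF_F2 dia tri x y z v.
  by rewrite /preF_F2 !triD !diaD; zmod.
have leibE := leibnizator_subadj lin_tri (pl3_skew pl) lin_dia.
move=> x1 x2 x3 x4 x5; rewrite [mul x1 (leibnizator _ _ _ _ _ _)]/subadj_mul.
(* [L] must act before [leibE] unfolds the leibnizators. The products of [x1] and [x2] with values
   of [preF_F2] that it yields cancel those coming from the last term of [leibE]; what remains is
   [preF_F2] at [mul x1 x2], split by [F2D]. *)
rewrite [mul x2 (leibnizator _ _ _ _ _ _)]/subadj_mul !L !leibE !F1 F2.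
rewrite [mul x1 x2]/subadj_mul F2D !(diaB, diaD).
by zmod.
Qed.

End SubAdjacent.

Section RotaBaxter.
Variables (K : fieldType) (A V : lmodType K).
Variables (mul : A -> A -> A) (br : A -> A -> A -> A).
Variables (rho : A -> A -> V -> V) (mu : A -> V -> V) (T : {linear V -> A}).
Hypothesis rrbT : is_relative_Rota_Baxter mul br rho mu T.
Let dia u v := mu (T u) v.
Let tri u v w := rho (T u) (T v) w.

Lemma rrb_hom : is_ternaryF_hom (subadj_mul dia) (subadj_br tri) mul br T.
Proof. by split=> *; rewrite (rrb_mul rrbT, rrb_br rrbT). Qed.

Lemma rrb_leibnizator x y z u :
  T (leibnizator (subadj_mul dia) (subadj_br tri) x y z u) =
    leibnizator mul br (T x) (T y) (T z) (T u).
Proof. by have [TM TB] := rrb_hom; rewrite /leibnizator !linearB !(TM, TB). Qed.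

Lemma rrb_F1 x y z u :
  preF_F1 dia tri x y z u = rep_L1 br rho mu (T x) (T y) (T z) u.
(* The third [dia] is the one applied to a sub-adjacent bracket; once [T] passes through it, both
   sides are convertible. *)
Proof. by have [_ TB] := rrb_hom; rewrite /preF_F1 {3}/dia TB. Qed.

Lemma rrb_F2 x y z u :
  preF_F2 dia tri x y z u = rep_L2 mul rho mu (T x) (T y) (T z) u.
Proof. by have [TM _] := rrb_hom; rewrite /preF_F2 {3}/tri TM. Qed.

Lemma rrb_ternary_preF_manifold :
  is_ternaryF_rep mul br rho mu -> is_ternary_preF_manifold dia tri.
Proof.
case=> [[[rho1 rho2 rho3] rhoN rho_comm rho_br] [[mu1 mu2] muM] L1 L2 L].
have [TM TB] := rrb_hom.
split; first split.
- by split=> [v a x y | u]; [rewrite /dia linearP mu1 | apply: mu2].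
(* The Zinbiel identity is multiplicativity of [mu] on the image of [T]. *)
- move=> x y z; rewrite /dia -muM -TM /subadj_mul linearD addrC.
  exact: linear_propD (mu1 z) _ _.
- split.
  + split=> [v w a x y | u w a x y | u v]; last exact: rho3.
      by rewrite /tri linearP rho1.
    by rewrite /tri linearP rho2.
  + by move=> x y z; apply: rhoN.
  (* The derivation identity is the commutator axiom of [rho] with one term moved across;
     skew-symmetry accounts for the sign. *)
  + move=> x1 x2 x3 x4 x5; rewrite /tri !TB (rhoN (T x3) (br _ _ _)).
    by apply/eqP; rewrite -subr_eq; apply/eqP; apply: rho_comm.
  + by move=> x1 x2 x3 x4 x5; rewrite {1}/tri TB; apply: rho_br.
- by move=> x1 x2 x3 x4 x5; rewrite !rrb_F1 TM L1.
- by move=> x1 x2 x3 x4 x5; rewrite !rrb_F2 TM L2.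
- by move=> x1 x2 x3 x4 x5; rewrite !rrb_F2 {1}/dia rrb_leibnizator L.
Qed.

End RotaBaxter.

Theorem theorem5p9 (K : closedFieldType) (charK0 : [pchar K] =i pred0)
    (A V : lmodType K)
    (mul : A -> A -> A) (br : A -> A -> A -> A)
    (rho : A -> A -> V -> V) (mu : A -> V -> V) (T : {linear V -> A}) :
  is_ternaryF_manifold mul br ->
  is_ternaryF_rep mul br rho mu ->
  is_relative_Rota_Baxter mul br rho mu T ->
  let dia := fun u v : V => mu (T u) v in
  let tri := fun u v w : V => rho (T u) (T v) w in
  is_ternary_preF_manifold dia tri /\
  (is_ternaryF_manifold (subadj_mul dia) (subadj_br tri) /\
   is_ternaryF_hom (subadj_mul dia) (subadj_br tri) mul br T).
Proof.
move=> _ rep rrbT dia tri.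
have preF : is_ternary_preF_manifold dia tri.
  exact: rrb_ternary_preF_manifold rep.
(* The axioms on [V] come from its pre-F structure rather than by pulling back along [T], which need
   not be injective. *)
by split=> //; split; [apply: subadj_ternaryF_manifold | apply: rrb_hom].
Qed.
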